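(* Fix an integer $n \geq 2$, a unital commutative ring $R$, and $f_0, f_1 \in R$. Let $u_i, v_j$ ($1 \leq i,j\leq n$) be odd (fermionic) variables and let $t$ be an indeterminate. Then \[ \begin{aligned} \det (f_0 + f_1 t u_i v_j)_{i,j=1}^n = {} & t^n (-1)^{\binom{n}{2}} n!\, f_1^n \cdot u_1 \cdots u_n \cdot v_1 \cdots v_n \\ & + t^{n-1} (-1)^{\binom{n-1}{2}} (n-1)!\, f_0 f_1^{n-1} \cdot \sum_{i=1}^n (-1)^{i-1} u_1 \cdots \widehat{u_i} \cdots u_n \cdot \sum_{j=1}^n (-1)^{j-1} v_1 \cdots \widehat{v_j} \cdots v_n . \end{aligned} \] Similarly, the permanent of the $n \times n$ matrix $(f_0 + f_1 t u_i v_j)_{i,j=1}^n$ equals \[ \mathrm{perm}(f_0 + f_1 t u_i v_j)_{i,j=1}^n = n!\, f_0^n + (n-1)!\, f_0^{n-1} f_1 t\, (u_1 + \cdots + u_n)(v_1 + \cdots + v_n). \]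
   Context: Odd (fermionic) variables: $u_1,\dots,u_n,v_1,\dots,v_n$ are the generators of the exterior algebra over $R$ of the free $R$-module with this basis. Thus they pairwise anticommute ($u_iu_j=-u_ju_i$, $v_iv_j=-v_jv_i$, $u_iv_j=-v_ju_i$) and $u_j^2=v_j^2=0$. The indeterminate $t$ commutes with everything. The elements $u_iv_j$ commute with one another, so the determinant and the permanent $\mathrm{perm}(A) = \sum_{\sigma\in S_n} a_{1\sigma(1)}\cdots a_{n\sigma(n)}$ are well-defined. A hat denotes an omitted factor. *)

(* Defs.v *)
From HB Require Import structures.
From mathcomp Require Import all_boot all_order all_fingroup all_algebra.

Set Implicit Arguments.
Unset Strict Implicit.
Unset Printing Implicit Defensive.

Import GRing.Theory.

Local Open Scope ring_scope.

(* The exterior algebra over R of the free R-module of rank m, with basis     *)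
(* [extgen i], i : 'I_m: a free R-module with one basis vector e_S for every  *)
(* S : {set 'I_m}, where e_S stands for the product of the generators         *)
(* indexed by S taken in increasing order. The multiplication is              *)
(*   e_S * e_T = (-1)^(extinv S T) e_(S :|: T)  if S and T are disjoint,      *)
(*             = 0                              otherwise,                    *)
(* where extinv S T is the number of transpositions needed to sort the        *)
(* product. That this is the exterior algebra is checked by extgen_sqr,       *)
(* extgen_anticomm, prod_extgen and extalg_expand: the generators satisfy     *)
(* the exterior relations, and their increasing products form a basis.        *)
Record extalg (R : Type) (m : nat) := ExtAlg {extcoef : {ffun {set 'I_m} -> R}}.

HB.instance Definition _ (R : Type) m := [isNew for @extcoef R m].
HB.instance Definition _ (R : choiceType) m := [Choice of extalg R m by <:].

Definition extinv m (S T : {set 'I_m}) : nat :=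
  (\sum_(i in S) \sum_(j in T) (j < i))%N.

Section ExtAlg.

Variables (R : comNzRingType) (m : nat).
Implicit Types (x y z : extalg R m) (S T U : {set 'I_m}) (a b : R).

Definition extalg_add x y : extalg R m := ExtAlg (extcoef x + extcoef y).
Definition extalg_opp x : extalg R m := ExtAlg (- extcoef x).
Definition extalg_zero : extalg R m := ExtAlg 0.

Fact extalg_addA : associative extalg_add.
Proof. by move=> x y z; congr ExtAlg; rewrite /= addrA. Qed.
Fact extalg_addC : commutative extalg_add.
Proof. by move=> x y; congr ExtAlg; rewrite /= addrC. Qed.
Fact extalg_add0 : left_id extalg_zero extalg_add.
Proof. by case=> x; congr ExtAlg; rewrite /= add0r. Qed.
Fact extalg_addN : left_inverse extalg_zero extalg_opp extalg_add.
Proof. by move=> x; congr ExtAlg; rewrite /= addNr. Qed.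

HB.instance Definition _ := GRing.isZmodule.Build (extalg R m)
  extalg_addA extalg_addC extalg_add0 extalg_addN.

Lemma extalgP x y : (forall S, extcoef x S = extcoef y S) -> x = y.
Proof. by case: x y => [x] [y] /= e; congr ExtAlg; apply/ffunP. Qed.

Lemma extcoefD x y S : extcoef (x + y) S = extcoef x S + extcoef y S.
Proof. by rewrite /= ffunE. Qed.

Lemma extcoefN x S : extcoef (- x) S = - extcoef x S.
Proof. by rewrite /= ffunE. Qed.

Lemma extcoef0 S : extcoef (0 : extalg R m) S = 0.
Proof. by rewrite /= ffunE. Qed.

Lemma extcoef_sum I (r : seq I) (P : pred I) (F : I -> extalg R m) S :
  extcoef (\sum_(i <- r | P i) F i) S = \sum_(i <- r | P i) extcoef (F i) S.
Proof.
by apply: (big_morph (fun x => extcoef x S)) => [x y|];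
   rewrite ?extcoefD ?extcoef0.
Qed.

Definition extalg_scale a x : extalg R m := ExtAlg [ffun S => a * extcoef x S].

Fact extalg_scaleA a b x :
  extalg_scale a (extalg_scale b x) = extalg_scale (a * b) x.
Proof. by apply: extalgP => S; rewrite !ffunE mulrA. Qed.
Fact extalg_scale1 : left_id 1 extalg_scale.
Proof. by move=> x; apply: extalgP => S; rewrite !ffunE mul1r. Qed.
Fact extalg_scaleDr : right_distributive extalg_scale +%R.
Proof.
by move=> a x y; apply: extalgP => S; rewrite extcoefD !ffunE mulrDr.
Qed.
Fact extalg_scaleDl x : {morph extalg_scale^~ x : a b / a + b}.
Proof. by move=> a b; apply: extalgP => S; rewrite extcoefD !ffunE mulrDl. Qed.

HB.instance Definition _ := GRing.Zmodule_isLmodule.Build R (extalg R m)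
  extalg_scaleA extalg_scale1 extalg_scaleDr extalg_scaleDl.

Lemma extcoefZ a x S : extcoef (a *: x) S = a * extcoef x S.
Proof. by rewrite /= ffunE. Qed.

Definition extbasis S : extalg R m := ExtAlg [ffun T => (T == S)%:R].

Definition extalg_one : extalg R m := extbasis set0.

(* The pairs (S, T) of disjoint sets with union U are the (S, U :\: S).       *)
Definition extalg_mul x y : extalg R m :=
  ExtAlg [ffun U : {set 'I_m} => \sum_(S : {set 'I_m} | S \subset U)
    (-1) ^+ extinv S (U :\: S) * (extcoef x S * extcoef y (U :\: S))].

Lemma extcoef_basis S T : extcoef (extbasis S) T = (T == S)%:R.
Proof. by rewrite ffunE. Qed.

Lemma extinv0s S : extinv set0 S = 0%N.
Proof. by rewrite /extinv big_set0. Qed.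

Lemma extinvs0 S : extinv S set0 = 0%N.
Proof. by rewrite /extinv big1 // => i _; rewrite big_set0. Qed.

Lemma extinvDl S S' T : S \subset S' ->
  extinv S' T = (extinv S T + extinv (S' :\: S) T)%N.
Proof. by move=> sSS'; rewrite /extinv (big_setID S) (setIidPr sSS'). Qed.

Lemma extinvDr S T T' : T \subset T' ->
  extinv S T' = (extinv S T + extinv S (T' :\: T))%N.
Proof.
move=> sTT'; rewrite /extinv -big_split; apply: eq_bigr => i _ /=.
by rewrite (big_setID T) (setIidPr sTT').
Qed.

Lemma extset_subDU S T : S \subset T -> S :|: (T :\: S) = T.
Proof.
move=> /subsetP sST; apply/setP=> i; rewrite !inE; have := sST i.
by case: (i \in S) => [->|].
Qed.

Fact extalg_mulA : associative extalg_mul.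
Proof.
move=> x y z; apply: extalgP => U; rewrite !ffunE.
pose F S A := (-1) ^+ (extinv S (A :\: S) + extinv A (U :\: A)) *
  (extcoef x S * extcoef y (A :\: S) * extcoef z (U :\: A)).
transitivity (\sum_(S : {set 'I_m} | S \subset U)
    \sum_(A : {set 'I_m} | (S \subset A) && (A \subset U)) F S A).
  apply: eq_bigr => S sSU; rewrite ffunE !big_distrr /=.
  rewrite (reindex_onto (fun A => A :\: S) (fun T => S :|: T)) /=; last first.
    move=> T; rewrite subsetD => /andP[_ dTS].
    by rewrite setDUl setDv set0U; apply/setDidPl.
  have eP A : (A :\: S \subset U :\: S) && (S :|: A :\: S == A) =
              (S \subset A) && (A \subset U).
    apply/andP/andP => [[sAU /eqP eA]|[sSA sAU]]; last first.
      by split; [apply: setSD | rewrite extset_subDU].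
    have sSA : S \subset A by rewrite -eA subsetUl.
    split=> //; rewrite -eA subUset sSU /=.
    exact: subset_trans sAU (subsetDl _ _).
  apply: eq_big => [A|A]; rewrite eP // => /andP[sSA sAU].
  have eUA : (U :\: S) :\: (A :\: S) = U :\: A by rewrite setDDl extset_subDU.
  have e1 : extinv S (U :\: S) = (extinv S (A :\: S) + extinv S (U :\: A))%N.
    by rewrite (extinvDr _ (setSD S sAU)) eUA.
  rewrite eUA e1 /F (extinvDl _ sSA) !exprD -!mulrA; congr (_ * _).
  by rewrite (mulrCA (extcoef x S)).
rewrite (exchange_big_dep (fun A : {set 'I_m} => A \subset U)) /=; last first.
  by move=> S A _ /andP[].
apply: eq_bigr => A sAU; rewrite ffunE big_distrl big_distrr /=.
apply: eq_big => [S|S /andP[sSU /andP[sSA _]]].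
  rewrite sAU andbT; apply/andP/idP => [[]//|sSA].
  by split=> //; apply: subset_trans sAU.
by rewrite /F addnC exprD -!mulrA.
Qed.

Fact extalg_mul1l : left_id extalg_one extalg_mul.
Proof.
move=> x; apply: extalgP => U; rewrite ffunE (bigD1 set0) ?sub0set //=.
rewrite big1 => [|S /andP[_ /negPf nS0]]; last first.
  by rewrite ffunE nS0 mul0r mulr0.
by rewrite ffunE eqxx setD0 extinv0s expr0 !mul1r addr0.
Qed.

Fact extalg_mul1r : right_id extalg_one extalg_mul.
Proof.
move=> x; apply: extalgP => U; rewrite ffunE (bigD1 U) //=.
rewrite big1 => [|S /andP[sSU nSU]]; last first.
  rewrite ffunE setD_eq0 (_ : U \subset S = false) ?mulr0 //.
  by apply/negbTE; apply: contra nSU => sUS; rewrite eqEsubset sSU.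
by rewrite setDv ffunE eqxx extinvs0 expr0 mul1r mulr1 addr0.
Qed.

Fact extalg_mulDl : left_distributive extalg_mul +%R.
Proof.
move=> x y z; apply: extalgP => U; rewrite extcoefD !ffunE -big_split /=.
by apply: eq_bigr => S _; rewrite ffunE mulrDl mulrDr.
Qed.

Fact extalg_mulDr : right_distributive extalg_mul +%R.
Proof.
move=> x y z; apply: extalgP => U; rewrite extcoefD !ffunE -big_split /=.
by apply: eq_bigr => S _; rewrite ffunE mulrDr mulrDr.
Qed.

Fact extalg_1neq0 : extalg_one != 0.
Proof.
apply/eqP => /(congr1 (fun x => extcoef x set0)) /eqP.
by rewrite extcoef0 ffunE eqxx oner_eq0.
Qed.

HB.instance Definition _ := GRing.Zmodule_isNzRing.Build (extalg R m)
  extalg_mulA extalg_mul1l extalg_mul1r extalg_mulDl extalg_mulDr extalg_1neq0.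

Lemma extcoefM x y U : extcoef (x * y) U =
  \sum_(S : {set 'I_m} | S \subset U)
    (-1) ^+ extinv S (U :\: S) * (extcoef x S * extcoef y (U :\: S)).
Proof. by rewrite ffunE. Qed.

Fact extalg_scaleAl a x y : a *: (x * y) = (a *: x) * y.
Proof.
apply: extalgP => U; rewrite extcoefZ !extcoefM big_distrr.
by apply: eq_bigr => S _ /=; rewrite extcoefZ mulrCA !mulrA.
Qed.

HB.instance Definition _ :=
  GRing.Lmodule_isLalgebra.Build R (extalg R m) extalg_scaleAl.

Fact extalg_scaleAr a x y : a *: (x * y) = x * (a *: y).
Proof.
apply: extalgP => U; rewrite extcoefZ !extcoefM big_distrr.
apply: eq_bigr => S _ /=; rewrite extcoefZ mulrCA; congr (_ * _).
by rewrite mulrCA.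
Qed.

HB.instance Definition _ :=
  GRing.Lalgebra_isAlgebra.Build R (extalg R m) extalg_scaleAr.

Lemma extbasisM S T : extbasis S * extbasis T =
  if [disjoint S & T] then (-1) ^+ extinv S T *: extbasis (S :|: T) else 0.
Proof.
apply: extalgP => U; rewrite extcoefM.
have E (A : {set 'I_m}) : A \subset U ->
    extcoef (extbasis S) A * extcoef (extbasis T) (U :\: A) =
    ((A == S) && (U :\: S == T))%:R.
  by move=> _; rewrite !ffunE -natrM mulnb; case: eqP => // ->.
under eq_bigr => A sAU do rewrite (E A sAU).
have [dST|ndST] := boolP [disjoint S & T]; last first.
  rewrite extcoef0 big1 // => A sAU; case: eqP => [eA|]; rewrite ?mulr0 //=.
  case: eqP => [eT|]; rewrite ?mulr0 //; case/negP: ndST.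
  by rewrite -eT -setI_eq0 setIDA setIC -setIDA setDv setI0.
rewrite extcoefZ extcoef_basis; have [->|neU] := eqVneq U (S :|: T).
  rewrite (bigD1 S) ?subsetUl //= big1 => [|A /andP[_ /negPf->]]; last first.
    by rewrite mulr0.
  have -> : (S :|: T) :\: S = T.
    rewrite setDUl setDv set0U; apply/setDidPl.
    by rewrite disjoint_sym.
  by rewrite !eqxx addr0.
rewrite mulr0 big1 // => A sAU; case: eqP => [eA|]; rewrite ?mulr0 //=.
case: eqP => [eT|]; rewrite ?mulr0 //; case/eqP: neU.
by rewrite -eT extset_subDU // -eA.
Qed.

Definition extgen (i : 'I_m) : extalg R m := extbasis [set i].

Lemma extgen_sqr i : extgen i * extgen i = 0.
Proof. by rewrite extbasisM -setI_eq0 setIid -cards_eq0 cards1. Qed.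

Lemma extgen_anticomm i j : extgen i * extgen j = - (extgen j * extgen i).
Proof.
have [->|neq] := eqVneq i j; first by rewrite extgen_sqr oppr0.
rewrite !extbasisM !disjoints1 !inE (negPf neq) eq_sym (negPf neq) /=.
rewrite setUC -scaleNr; congr (_ *: _); rewrite /extinv !big_set1.
by move: neq; rewrite neq_ltn; case: ltngtP => //= _ _; rewrite ?expr0 ?expr1 ?opprK.
Qed.

Lemma prod_extgen S : \prod_(i in S) extgen i = extbasis S.
Proof.
have E (s : seq 'I_m) : sorted ltn (map val s) ->
    \prod_(i <- s) extgen i = extbasis [set i in s].
  elim: s => [|i s IHs] si; first by rewrite big_nil set_nil.
  rewrite big_cons IHs ?(path_sorted si) // extbasisM.
  have lt_i j : j \in s -> (i < j)%N.
    move=> js; move: si; rewrite /= path_sortedE; last exact: ltn_trans.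
    by case/andP=> /allP/(_ _ (map_f val js)).
  rewrite disjoints1 inE ifT; last first.
    by apply/negP => js; have := lt_i _ js; rewrite ltnn.
  rewrite set_cons /extinv big_set1 big1 ?expr0 ?scale1r // => j.
  by rewrite inE => js; rewrite ltnNge ltnW // lt_i.
rewrite -big_filter E.
  by congr extbasis; apply/setP=> i; rewrite inE mem_filter mem_index_enum andbT.
apply: subseq_sorted ltn_trans _ _ (map_subseq val (filter_subseq _ _)) _.
by rewrite [index_enum _]unlock -enumT val_enum_ord iota_ltn_sorted.
Qed.

Lemma extalg_expand x :
  x = \sum_(S : {set 'I_m}) extcoef x S *: \prod_(i in S) extgen i.
Proof.
apply: extalgP => T; rewrite extcoef_sum.
under eq_bigr => S _ do rewrite prod_extgen extcoefZ extcoef_basis.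
rewrite (bigD1 T) //= big1 => [|S /negPf nST]; last by rewrite eq_sym nST mulr0.
by rewrite eqxx mulr1 addr0.
Qed.

End ExtAlg.

Arguments extgen R {m} i.

(* The odd variables u_1, ..., u_n, v_1, ..., v_n are the 2n generators, in   *)
(* this order; indices start at 0.                                            *)
Definition oddu (R : comNzRingType) (n : nat) (i : 'I_n) : extalg R (n + n) :=
  extgen R (lshift n i).

Definition oddv (R : comNzRingType) (n : nat) (j : 'I_n) : extalg R (n + n) :=
  extgen R (rshift n j).

(* R[t] and the odd variables both live in {poly (extalg R (n + n))}, whose   *)
(* variable 'X plays the role of t and commutes with the coefficients.        *)
Definition extpolyC (R : comNzRingType) (m : nat) (a : R) :
  {poly (extalg R m)} := (a%:A)%:P.

(* As for \det, the product is taken in the order of the rows, which is       *)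
(* immaterial when the entries of A commute.                                  *)
Definition permanent (A : nzRingType) (n : nat) (M : 'M[A]_n) : A :=
  \sum_(s : 'S_n) \prod_(i < n) M i (s i).

Definition oddmx (R : comNzRingType) (n : nat) (f0 f1 : R) :
    'M[{poly (extalg R (n + n))}]_n :=
  \matrix_(i < n, j < n)
    (extpolyC _ f0 + extpolyC _ f1 * 'X * (oddu R i * oddv R j)%:P).

Lemma oddmx_comm (R : comNzRingType) (n : nat) (f0 f1 : R) (i j k l : 'I_n) :
  GRing.comm (oddmx n f0 f1 i j) (oddmx n f0 f1 k l).
Proof.
have cR a (p : {poly (extalg R (n + n))}) : GRing.comm (extpolyC _ a) p.
  apply/polyP=> d; rewrite coefCM coefMC.
  by rewrite -scalerAl -scalerAr mul1r mulr1.
have cX (p : {poly (extalg R (n + n))}) : GRing.comm 'X p.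
  exact/commr_sym/commr_polyX.
have cuv : GRing.comm (oddu R i * oddv R j) (oddu R k * oddv R l).
  rewrite /GRing.comm /oddu /oddv -!mulrA.
  rewrite [in LHS](mulrA (extgen R (rshift n j))).
  rewrite [in LHS](extgen_anticomm _ (rshift n j)) mulNr mulrN -!mulrA.
  rewrite [in LHS](extgen_anticomm _ (rshift n j)) mulrN mulrN opprK.
  rewrite !mulrA [in LHS](extgen_anticomm _ (lshift n i)) !mulNr -!mulrA.
  rewrite [in LHS](mulrA (extgen R (lshift n i))).
  by rewrite [in LHS](extgen_anticomm _ (lshift n i)) mulNr mulrN opprK !mulrA.
have cuvP : GRing.comm (oddu R i * oddv R j)%:P (oddu R k * oddv R l)%:P.
  by rewrite /GRing.comm -!polyCM cuv.
rewrite !mxE; apply: commrD; apply/commr_sym; first exact: cR.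
apply: commrD; first exact/commr_sym/cR.
apply: commrM; last apply/commr_sym/commrM; last exact/commr_sym.
- by apply: commrM; apply/commr_sym; [apply: cR | apply: cX].
- by apply: commrM; apply/commr_sym; [apply: cR | apply: cX].
Qed.

(* Main.v *)
Require Import Defs.
From mathcomp Require Import all_boot all_order all_fingroup all_algebra.

Set Implicit Arguments.
Unset Strict Implicit.
Unset Printing Implicit Defensive.

Import GRing.Theory.

Local Open Scope ring_scope.

(* Expand every product of entries over the set A of rows in which the term   *)
(* f1 t u_i v_j is chosen. Since u's anticommute with v's, the u-part and the *)
(* v-part of the A-term separate, at the cost of a sign that depends only on  *)
(* #|A|, and what remains is a (signed) sum over s of the products of the     *)
(* v_(s i), i in A. In the permanent this sum is alternating under a          *)
(* transposition of two elements of A, so only #|A| <= 1 contributes; in the  *)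
(* determinant it is alternating under a transposition of two elements        *)
(* outside A, so only #|A| >= n - 1 contributes.                              *)

(** Both formulas hold in any ring for central [a], [b] (here f0 and f1 t) and families u, v such
    that every u_i anticommutes with every v_j and the v's anticommute among themselves:
    [permanent_anticomm] and [det_anticomm]. The expansion over A is [sum_perm_expand], whose sign
    (-1)^C(#|A|, 2) comes from [prod_anticomm_mul]; the cancellation for the other sets A is
    [sum_perm_alternating]. The surviving terms are then counted. In the permanent, A empty gives n!
    equal terms, and A = {i} gives u_i times a sum over s of v_(s i), in which each v_j occurs
    (n-1)! times ([sum_perm_at]). In the determinant, sorting the v's costs exactly the sign of s
    ([prod_anticomm_perm]), so when A is everything all n! terms agree. When only row i is outside
    A, the sign left over is (-1)^(i + s i) ([prod_anticomm_perm_neq]), which makes the sum factor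
    into two alternating sums. *)

(* big_enum_val is only available for commutative laws. *)
Lemma prod_in_ord (B : nzRingType) (I : finType) (A : {set I}) :
  exists f : 'I_#|A| -> I,
    [/\ injective f, forall i, i \in A -> exists l, f l = i
      & forall F : I -> B, \prod_(i in A) F i = \prod_(l < #|A|) F (f l)].
Proof.
case: (big_enumP (mem A)) => e big_e [Ue mem_e] [_ size_e].
have -> : #|A| = size e by rewrite size_e.
exists (tnth (in_tuple e)); split=> [|i|F]; first exact/tuple_uniqP.
  by rewrite -[i \in A]mem_e => /(tnthP (in_tuple e))[l ->]; exists l.
by rewrite -big_e big_tnth.
Qed.

(** * Removing one index from products and permutations *)

Lemma lift_lift0 n (i : 'I_n.+1) (j : 'I_n) :
  lift (lift ord0 i) (lift ord0 j) = lift ord0 (lift i j).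
Proof. by apply: val_inj; rewrite /= /bump /= !add1n ltnS addnS. Qed.

Lemma prod_setT (B : nzRingType) (I : finType) (F : I -> B) :
  \prod_(i in [set: I]) F i = \prod_i F i.
Proof. by apply: eq_bigl => i; rewrite inE. Qed.

Lemma prod_setC1 (B : nzRingType) (I : finType) (x : I) (F : I -> B) :
  \prod_(i in [set~ x]) F i = \prod_(i | i != x) F i.
Proof. by apply: eq_bigl => i; rewrite !inE. Qed.

Lemma prod_neq_lift (B : nzRingType) n (i : 'I_n.+1) (F : 'I_n.+1 -> B) :
  \prod_(k < n.+1 | k != i) F k = \prod_(l < n) F (lift i l).
Proof.
elim: n i F => [|n IHn] i F.
  by rewrite big_ord0 big_pred0 // => k; rewrite !ord1.
rewrite big_mkcond [LHS]big_ord_recl /=; case: (unliftP ord0 i) => [j|] ->.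
  rewrite [RHS]big_ord_recl; congr (F _ * _); first exact: val_inj.
  transitivity (\prod_(k < n.+1 | k != j) F (lift ord0 k)).
    rewrite [RHS]big_mkcond; apply: eq_bigr => k _.
    by rewrite (inj_eq lift_inj).
  by rewrite IHn; apply: eq_bigr => l _; rewrite lift_lift0.
by rewrite mul1r; apply: eq_bigr.
Qed.

Lemma lift_perm_ex n (s : 'S_n.+1) i : exists s', s = lift_perm i (s i) s'.
Proof.
(* The default [k] is never returned: [lift i k] differs from [i], so its image differs from
   [s i]. *)
pose f k := odflt k (unlift (s i) (s (lift i k))).
have fK k : lift (s i) (f k) = s (lift i k).
  rewrite /f; have := neq_lift i k.
  by rewrite -(inj_eq (@perm_inj _ s)) => /unlift_some[] ? ? ->.
have f_inj : injective f.
  by move=> k l /(congr1 (lift (s i))); rewrite !fK => /perm_inj /lift_inj.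
exists (perm f_inj); apply/permP => k.
case: (unliftP i k) => [l|] ->; last by rewrite lift_perm_id.
by rewrite lift_perm_lift permE fK.
Qed.

(** The permutations with [s i = j] are the [lift_perm i j t], one for each [t] in ['S_n], so each
    [j] is hit n! times. *)
Lemma sum_perm_at (V : zmodType) n (i : 'I_n.+1) (G : 'I_n.+1 -> V) :
  \sum_(s : 'S_n.+1) G (s i) = (\sum_j G j) *+ n`!.
Proof.
rewrite (partition_big (fun s : 'S_n.+1 => s i) predT) //= -sumrMnl.
apply: eq_bigr => j _; rewrite (eq_bigr (fun=> G j)) => [|s /eqP-> //].
have lift_permI : injective (lift_perm i j : 'S_n -> 'S_n.+1).
  move=> s t eq_st; apply/permP=> k; apply: (@lift_inj _ j).
  by rewrite -!(lift_perm_lift i j) eq_st.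
rewrite sumr_const -[in RHS]card_Sn -(card_imset predT lift_permI).
congr (_ *+ _); apply: eq_card => s; rewrite unfold_in.
apply/(@eqP _ (s i) j)/imsetP => [eq_j|[t _ ->]]; last by rewrite lift_perm_id.
by have [t] := lift_perm_ex s i; rewrite eq_j => ->; exists t.
Qed.

(** Multiplication by the transposition exchanges even and odd permutations, so the two halves of
    the sum are opposite. Showing only that twice the sum is 0 would not suffice in the presence of
    2-torsion. *)
Lemma sum_perm_alternating (V : zmodType) (T : finType) (x y : T)
    (F : {perm T} -> V) :
  x != y -> (forall s, F (tperm x y * s)%g = - F s) -> \sum_s F s = 0.
Proof.
move=> neq_xy F_alt; rewrite (bigID (fun s : {perm T} => odd_perm s)) /=.
rewrite (reindex_inj (mulgI (tperm x y))) /=.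
rewrite [X in X + _](_ : _ = - \sum_(s | ~~ odd_perm s) F s) ?addNr //.
rewrite -sumrN; apply: eq_big => [s|s _]; last exact: F_alt.
by rewrite odd_permM odd_tperm neq_xy addTb.
Qed.

(** * Sums over sets with at most one element *)

Section Sets.

Variables (V : nmodType) (T : finType).

Lemma sum_card1 (F : {set T} -> V) :
  \sum_(A : {set T} | #|A| == 1%N) F A = \sum_i F [set i].
Proof.
rewrite -(big_imset _ (in2W set1_inj)); apply: eq_bigl => A.
by apply/cards1P/imsetP => [[x ->]|[x _ ->]]; exists x.
Qed.

Lemma sum_card_le1 (F : {set T} -> V) :
  (forall A : {set T}, (1 < #|A|)%N -> F A = 0) ->
  \sum_A F A = F set0 + \sum_i F [set i].
Proof.
move=> F0; rewrite (bigD1 set0) //= -(sum_card1 F); congr (_ + _).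
rewrite (bigID (fun A : {set T} => #|A| == 1%N)) /= [X in _ + X]big1 ?addr0.
  by apply: eq_bigl => A; apply/andb_idl => /eqP A1; rewrite -cards_eq0 A1.
move=> A /andP[]; rewrite -cards_eq0 => A0 A1; apply: F0.
by case: #|A| A0 A1 => [|[]].
Qed.

End Sets.

(** * Sign rules for anticommuting families *)

Section Anticommuting.

Variable B : nzRingType.

Definition anticommuting (I : eqType) (w : I -> B) :=
  forall i j, i != j -> w i * w j = - (w j * w i).

Lemma anticommuting_inj (I J : eqType) (w : I -> B) (h : J -> I) :
  injective h -> anticommuting w -> anticommuting (w \o h).
Proof. by move=> h_inj w_anti i j ij; apply: w_anti; rewrite inj_eq. Qed.

Lemma mulr_signC (x : B) n : x * (-1) ^+ n = (-1) ^+ n * x.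
Proof. exact: commr_sign. Qed.

Lemma anticomm_prod n (x : B) (w : 'I_n -> B) :
  (forall i, x * w i = - (w i * x)) ->
  x * \prod_i w i = (-1) ^+ n * (\prod_i w i * x).
Proof.
elim: n w => [|n IHn] w xw; first by rewrite !big_ord0 expr0 !(mul1r, mulr1).
rewrite !big_ord_recl mulrA xw mulNr -[w ord0 * x * _]mulrA IHn; last first.
  by move=> i; exact: xw.
by rewrite mulrA mulr_signC exprS mulN1r !mulNr !mulrA.
Qed.

(** Moving [w j] back to its place crosses the [j] factors that precede it. *)
Lemma prod_anticomm_lift n (w : 'I_n.+1 -> B) j : anticommuting w ->
  w j * \prod_l w (lift j l) = (-1) ^+ j * \prod_i w i.
Proof.
elim: n w j => [|n IHn] w j w_anti.
  by rewrite !ord1 big_ord0 big_ord1 expr0 mul1r mulr1.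
case: (unliftP ord0 j) => [k|] ->; last first.
  by rewrite expr0 mul1r [RHS]big_ord_recl.
rewrite big_ord_recl [in RHS]big_ord_recl /=.
have -> : lift (lift ord0 k) ord0 = ord0 by apply: val_inj.
rewrite mulrA w_anti // mulNr -mulrA.
have /= := IHn (w \o lift ord0) k (anticommuting_inj lift_inj w_anti).
under [in LHS]eq_bigr do rewrite -lift_lift0.
by move=> ->; rewrite mulrA mulr_signC exprS mulN1r !mulNr mulrA.
Qed.

(** With [s = lift_perm ord0 j t], induction handles [t], and putting [w j] in place costs (-1)^j,
    the ratio of the signs of [s] and [t]. *)
Lemma prod_anticomm_perm n (w : 'I_n -> B) (s : 'S_n) : anticommuting w ->
  \prod_i w (s i) = (-1) ^+ s * \prod_i w i.
Proof.
elim: n w s => [|n IHn] w s w_anti.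
  rewrite !big_ord0; have -> : s = 1%g by apply/permP => [[]].
  by rewrite odd_perm1 mulr1.
have [t] := lift_perm_ex s ord0; move: (s ord0) => j ->.
rewrite big_ord_recl lift_perm_id.
rewrite (eq_bigr (fun l => w (lift j (t l)))) => [|l _]; last first.
  by rewrite lift_perm_lift.
rewrite (IHn (w \o lift j)) /=; last exact: anticommuting_inj lift_inj w_anti.
rewrite mulrA mulr_signC -mulrA prod_anticomm_lift // mulrA odd_lift_perm.
by rewrite addFb addbC signr_addb signr_odd.
Qed.

(** Erasing row [i] and column [s i] from the permutation matrix of [s] leaves a [t] whose sign is
    that of [s] times (-1)^(i + s i), as for cofactors. Sorting the factors costs the sign of [t],
    so only (-1)^(i + s i) remains. *)
Lemma prod_anticomm_perm_neq n (w : 'I_n.+1 -> B) (s : 'S_n.+1) i :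
    anticommuting w ->
  (-1) ^+ s * \prod_(k | k != i) w (s k) =
    (-1) ^+ i * ((-1) ^+ s i * \prod_(k | k != s i) w k).
Proof.
move=> w_anti; have [t] := lift_perm_ex s i; move: (s i) => j ->.
rewrite !prod_neq_lift.
rewrite (eq_bigr (fun l => w (lift j (t l)))) => [|l _]; last first.
  by rewrite lift_perm_lift.
rewrite (prod_anticomm_perm _ (anticommuting_inj (@lift_inj _ j) w_anti)).
by rewrite odd_lift_perm 2!signr_addb 2!signr_odd -!mulrA signrMK.
Qed.

(** In the inductive step v_0 crosses the [n] later u's, and C(n + 1, 2) = C(n, 2) + n. *)
Lemma prod_anticomm_mul n (u v : 'I_n -> B) :
  (forall i j, u i * v j = - (v j * u i)) ->
  \prod_i (u i * v i) = (-1) ^+ 'C(n, 2) * (\prod_i u i * \prod_i v i).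
Proof.
elim: n u v => [|n IHn] u v uv; first by rewrite !big_ord0 expr0 !mulr1.
rewrite !big_ord_recl IHn // binS bin1 exprD.
set U := \prod_i _; set V := \prod_i _.
have vU : v ord0 * U = (-1) ^+ n * (U * v ord0).
  by apply: anticomm_prod => i; rewrite uv opprK.
transitivity ((-1) ^+ 'C(n, 2) * (u ord0 * (v ord0 * U) * V)).
  by rewrite !mulrA mulr_signC !mulrA.
by rewrite vU -!mulrA (mulrA (u ord0)) mulr_signC -!mulrA.
Qed.

Lemma prod_in_anticomm_mul (I : finType) (A : {set I}) (u v : I -> B) :
  (forall i j, u i * v j = - (v j * u i)) ->
  \prod_(i in A) (u i * v i) =
    (-1) ^+ 'C(#|A|, 2) * (\prod_(i in A) u i * \prod_(i in A) v i).
Proof.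
have [h [_ _ prodE]] := prod_in_ord B A => uv; rewrite !prodE.
exact: (@prod_anticomm_mul _ (u \o h) (v \o h) (fun i j => uv _ _)).
Qed.

(** Through an enumeration of [A], the transposition becomes one of two positions in the product,
    which has sign -1. *)
Lemma prod_in_anticomm_tperm (I : finType) (A : {set I}) (w : I -> B) x y :
    anticommuting w -> x != y -> x \in A -> y \in A ->
  \prod_(i in A) w (tperm x y i) = - \prod_(i in A) w i.
Proof.
have [h [h_inj h_onto prodE]] := prod_in_ord B A => w_anti neq_xy.
move=> /h_onto[k hk] /h_onto[l hl]; rewrite -{}hk -{}hl in neq_xy *.
rewrite !prodE.
transitivity (\prod_i w (h (tperm k l i))).
  by apply: eq_bigr => i _; rewrite inj_tperm.
rewrite (prod_anticomm_perm _ (anticommuting_inj h_inj w_anti)) odd_tperm.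
by rewrite -(inj_eq h_inj) neq_xy expr1 mulN1r.
Qed.

(** * Expansion over the set of rows where the odd term is chosen *)

Lemma prod_affine (I : finType) (c : I -> B) (a b : B) :
    (forall x, GRing.comm a x) -> (forall x, GRing.comm b x) ->
  \prod_i (a + b * c i) = \sum_(A : {set I})
    a ^+ #|~: A| * b ^+ #|A| * \prod_(i in A) c i.
Proof.
(* The summands are swapped so that [A] collects the indices where [b * c i], not [a], is chosen. *)
move=> aC bC; under eq_bigr do rewrite addrC.
rewrite bigA_distr; apply: eq_bigr => A _; rewrite -!sum1_card.
elim: (index_enum I) => [|i r IHr]; first by rewrite !big_nil !expr0 !mulr1.
rewrite !big_cons IHr inE; case: (i \in A) => /=.
  set X := a ^+ _; set Y := b ^+ _; set P := \prod_(j <- r | _) _.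
  have cX : c i * X = X * c i by apply/commrX/commr_sym/aC.
  have cY : c i * Y = Y * c i by apply/commrX/commr_sym/bC.
  have bX : b * X = X * b by apply: bC.
  rewrite add1n exprS -/Y !mulrA -(mulrA b) cX !mulrA bX -(mulrA _ (c i)) cY.
  by rewrite !mulrA.
by rewrite add1n exprS !mulrA.
Qed.

(** [e] is the parity for the determinant and constantly false for the permanent, so that one
    expansion serves both. *)
Lemma sum_perm_expand n (u v : 'I_n -> B) (a b : B) (e : 'S_n -> bool) :
    (forall x, GRing.comm a x) -> (forall x, GRing.comm b x) ->
    (forall i j, u i * v j = - (v j * u i)) ->
  \sum_(s : 'S_n) (-1) ^+ e s * \prod_i (a + b * (u i * v (s i))) =
  \sum_(A : {set 'I_n}) a ^+ #|~: A| * b ^+ #|A| * (-1) ^+ 'C(#|A|, 2) *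
    (\prod_(i in A) u i * \sum_(s : 'S_n) (-1) ^+ e s * \prod_(i in A) v (s i)).
Proof.
move=> aC bC uv; under eq_bigr => s _.
  rewrite (prod_affine (fun i => u i * v (s i)) aC bC) mulr_sumr; over.
rewrite exchange_big; apply: eq_bigr => A _ /=; rewrite !mulr_sumr.
apply: eq_bigr => s _; rewrite (prod_in_anticomm_mul A (fun i j => uv i (s j))).
rewrite -[LHS]mulr_signC -!mulrA; congr (_ * (_ * (_ * (_ * _)))).
exact: mulr_signC.
Qed.

(** * The permanent and the determinant in a general ring *)

Lemma permanent_anticomm m (u v : 'I_m.+1 -> B) (a b : B) :
    (forall x, GRing.comm a x) -> (forall x, GRing.comm b x) ->
    (forall i j, u i * v j = - (v j * u i)) ->
    anticommuting v ->
  permanent (\matrix_(i, j) (a + b * (u i * v j))) =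
    a ^+ m.+1 *+ m.+1`! + (a ^+ m * b * ((\sum_i u i) * (\sum_j v j))) *+ m`!.
Proof.
move=> aC bC uv v_anti.
transitivity (\sum_(s : 'S_m.+1)
    (-1) ^+ false * \prod_i (a + b * (u i * v (s i)))).
  apply: eq_bigr => s _; rewrite mul1r.
  by apply: eq_bigr => i _; rewrite mxE.
rewrite (sum_perm_expand (fun=> false) aC bC uv).
have signless (A : {set 'I_m.+1}) :
    \sum_(s : 'S_m.+1) (-1) ^+ false * \prod_(i in A) v (s i) =
    \sum_(s : 'S_m.+1) \prod_(i in A) v (s i).
  by apply: eq_bigr => s _; rewrite mul1r.
rewrite sum_card_le1 => [|A /card_gt1P[x [y [Ax Ay neq_xy]]]]; last first.
  (* Both [x] and [y] lie in [A], so the transposition swaps two anticommuting factors. *)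
  rewrite signless (sum_perm_alternating neq_xy) ?mulr0 // => s.
  have vs_anti := anticommuting_inj (@perm_inj _ s) v_anti.
  rewrite -(prod_in_anticomm_tperm vs_anti neq_xy) //.
  by apply: eq_bigr => i _; rewrite /= permM.
congr (_ + _).
  rewrite signless setC0 cardsT card_ord cards0 expr0 !mulr1 big_set0 mul1r.
  rewrite (eq_bigr (fun=> 1)) => [|s _]; last by rewrite big_set0.
  by rewrite sumr_const card_Sn mulr_natr.
rewrite mulr_suml mulr_sumr -sumrMnl; apply: eq_bigr => i _.
rewrite signless cardsC1 card_ord cards1 expr1 mulr1 big_set1.
rewrite (eq_bigr (fun s : 'S__ => v (s i))) => [|s _]; last by rewrite big_set1.
by rewrite sum_perm_at !mulrnAr.
Qed.

Lemma det_anticomm m (u v : 'I_m.+1 -> B) (a b : B) :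
    (forall x, GRing.comm a x) -> (forall x, GRing.comm b x) ->
    (forall i j, u i * v j = - (v j * u i)) ->
    anticommuting v ->
  \det (\matrix_(i, j) (a + b * (u i * v j))) =
    (b ^+ m.+1 * (-1) ^+ 'C(m.+1, 2) * (\prod_i u i * \prod_j v j)) *+ m.+1`!
    + (a * b ^+ m * (-1) ^+ 'C(m, 2)
        * ((\sum_(i < m.+1) (-1) ^+ i * \prod_(k | k != i) u k)
           * (\sum_(j < m.+1) (-1) ^+ j * \prod_(k | k != j) v k))) *+ m`!.
Proof.
move=> aC bC uv v_anti.
transitivity (\sum_(s : 'S_m.+1) (-1) ^+ s * \prod_i (a + b * (u i * v (s i)))).
  apply: eq_bigr => s _; congr (_ * _).
  by apply: eq_bigr => i _; rewrite mxE.
(* After complementation, [A] is the set of rows where the constant [a] is chosen. *)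
rewrite (sum_perm_expand (@odd_perm _) aC bC uv) (reindex_inj (@setC_inj _)) /=.
rewrite sum_card_le1 => [|A /card_gt1P[x [y [Ax Ay neq_xy]]]]; last first.
  (* The product runs over rows other than [x] and [y], so the transposition changes only the sign
     of [s]. *)
  rewrite (sum_perm_alternating neq_xy) ?mulr0 // => s.
  rewrite odd_permM odd_tperm neq_xy signrN mulNr; congr (- (_ * _)).
  apply: eq_bigr => i; rewrite permM inE => Ai; rewrite tpermD //.
    by apply: contraNneq Ai => <-.
  by apply: contraNneq Ai => <-.
congr (_ + _).
  rewrite setC0 setCT cardsT card_ord cards0 expr0 mul1r.
  rewrite (eq_bigr (fun _ : 'S_m.+1 => \prod_i v i)) => [|s _]; last first.
    by rewrite prod_setT prod_anticomm_perm // signrMK.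
  by rewrite prod_setT sumr_const card_Sn !mulrnAr.
rewrite mulr_suml mulr_sumr -sumrMnl; apply: eq_bigr => i _.
rewrite setCK cards1 expr1 cardsC1 card_ord.
pose G (j : 'I_m.+1) := (-1) ^+ j * \prod_(k | k != j) v k.
rewrite (eq_bigr (fun s : 'S__ => (-1) ^+ i * G (s i))) => [|s _]; last first.
  rewrite -prod_anticomm_perm_neq //.
  by rewrite prod_setC1.
rewrite -mulr_sumr (sum_perm_at i G).
rewrite !mulrnAr; congr (_ * _ *+ _).
by rewrite prod_setC1 !mulrA mulr_signC.
Qed.

End Anticommuting.

(** * Specialization to the odd variables *)

Section OddMatrix.

Variable R : comNzRingType.

Lemma extpolyC_comm (m : nat) (a : R) (p : {poly extalg R m}) :
  GRing.comm (extpolyC m a) p.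
Proof.
apply/polyP => d; rewrite coefCM coefMC.
by rewrite -scalerAl -scalerAr mul1r mulr1.
Qed.

Lemma extpolyCX (m : nat) (a : R) k : extpolyC m (a ^+ k) = extpolyC m a ^+ k.
Proof. by rewrite /extpolyC -rmorphXn -(rmorphXn (in_alg (extalg R m))). Qed.

Lemma extpolyCM (m : nat) (a b : R) :
  extpolyC m (a * b) = extpolyC m a * extpolyC m b.
Proof. by rewrite /extpolyC -rmorphM -(rmorphM (in_alg (extalg R m))). Qed.

Lemma oddv_anticomm n : anticommuting (fun j : 'I_n => (oddv R j)%:P).
Proof.
by move=> i j _; rewrite -!polyCM -polyCN; congr _%:P; apply: extgen_anticomm.
Qed.

Lemma oddu_oddv_anticomm n (i j : 'I_n) :
  (oddu R i)%:P * (oddv R j)%:P = - ((oddv R j)%:P * (oddu R i)%:P).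
Proof. by rewrite -!polyCM -polyCN; congr _%:P; apply: extgen_anticomm. Qed.

End OddMatrix.

Theorem proposition3p2 (n : nat) (n_ge2 : (2 <= n)%N) (R : comNzRingType)
    (f0 f1 : R) :
  \det (oddmx n f0 f1) =
      'X^n * (-1) ^+ 'C(n, 2) * n`!%:R * extpolyC _ (f1 ^+ n)
        * (\prod_(i < n) oddu R i * \prod_(j < n) oddv R j)%:P
    + 'X^(n - 1) * (-1) ^+ 'C(n - 1, 2) * (n - 1)`!%:R
        * extpolyC _ (f0 * f1 ^+ (n - 1))
        * ((\sum_(i < n) (-1) ^+ i * \prod_(k < n | k != i) oddu R k)
           * (\sum_(j < n) (-1) ^+ j * \prod_(k < n | k != j) oddv R k))%:P
  /\
  permanent (oddmx n f0 f1) =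
      n`!%:R * extpolyC _ (f0 ^+ n)
    + (n - 1)`!%:R * extpolyC _ (f0 ^+ (n - 1) * f1) * 'X
        * ((\sum_(i < n) oddu R i) * (\sum_(j < n) oddv R j))%:P.
Proof.
case: n n_ge2 => // m _; rewrite subn1 /=.
(* The general formulas are applied with [a] = f0 and [b] = f1 t, both central, and the odd
   variables as constant polynomials. *)
have aC := @extpolyC_comm R (m.+1 + m.+1) f0.
have bC (p : {poly extalg R (m.+1 + m.+1)}) : GRing.comm (extpolyC _ f1 * 'X) p.
  apply/commr_sym/commrM; first exact/commr_sym/extpolyC_comm.
  exact: commr_polyX.
have MX k : (extpolyC (m.+1 + m.+1) f1 * 'X) ^+ k = 'X^k * extpolyC _ (f1 ^+ k).
  rewrite exprMn_comm -?extpolyCX; last exact: extpolyC_comm.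
  exact: extpolyC_comm.
pose u (i : 'I_m.+1) := (oddu R i)%:P; pose v (j : 'I_m.+1) := (oddv R j)%:P.
have -> : oddmx m.+1 f0 f1 =
    \matrix_(i, j) (extpolyC _ f0 + extpolyC _ f1 * 'X * (u i * v j)).
  by apply/matrixP => i j; rewrite !mxE polyCM.
have uv := @oddu_oddv_anticomm R m.+1; have v_anti := @oddv_anticomm R m.+1.
have CA a (p q : {poly extalg R (m.+1 + m.+1)}) :
    p * extpolyC _ a * q = p * q * extpolyC _ a.
  by rewrite -mulrA extpolyC_comm mulrA.
split.
  rewrite (det_anticomm aC bC uv v_anti) !MX.
  have sumE (w : 'I_m.+1 -> extalg R (m.+1 + m.+1)) :
      (\sum_(i < m.+1) (-1) ^+ i * \prod_(k < m.+1 | k != i) w k)%:P =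
      \sum_(i < m.+1) (-1) ^+ i * \prod_(k < m.+1 | k != i) (w k)%:P.
    rewrite rmorph_sum; apply: eq_bigr => i _.
    by rewrite rmorphMsign rmorph_prod.
  rewrite !polyCM !sumE !rmorph_prod; congr (_ + _).
    rewrite -mulrnAl; congr (_ * _).
    by rewrite CA -mulrnAl mulr_natr.
  rewrite -mulrnAl -[_ * _ * _ ^+ 'C(m, 2)]mulrA extpolyC_comm CA -mulrA.
  by rewrite -extpolyCM [_ * f0]mulrC -mulrnAl mulr_natr.
rewrite (permanent_anticomm aC bC uv v_anti) extpolyCX mulr_natl; congr (_ + _).
rewrite polyCM !rmorph_sum -mulrnAl; congr (_ * _).
by rewrite extpolyCM extpolyCX -!mulrA mulr_natl.
Qed.
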